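(* Let $q\ge 2$, $n\ge 3$ and let $k$ be an integer with $2\le k\le n-2$. Then the cardinality of $\mathcal S_{k,q}(n)$ is $$|\mathcal S_{k,q}(n)|=(q-1)^2F_{k,q}(n-k-2).$$
   Context: Let $\mathbb Z_q=\{0,\dots,q-1\}$. For $2\le k\le n-2$, $\mathcal S_{k,q}(n)$ is the set of all words $(s_1,\dots,s_n)\in\mathbb Z_q^n$ such that (1) $s_1=\cdots=s_k=0$, $s_{k+1}\ne 0$ and $s_n\ne 0$; and (2) the subsequence $(s_{k+2},s_{k+3},\dots,s_{n-1})$ does not contain any string of $k$ consecutive $0$'s. The $(q-1)$-weighted $k$-generalized Fibonacci sequence $F_{k,q}$ is defined by $F_{k,q}(n)=q^n$ for $0\le n\le k-1$ and $F_{k,q}(n)=(q-1)\sum_{l=1}^k F_{k,q}(n-l)$ for $n\ge k$. *)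

(* Defs.v *)
From mathcomp Require Import all_boot.

Set Implicit Arguments.
Unset Strict Implicit.
Unset Printing Implicit Defensive.

(* Words over Z_q are q-ary tuples s : n.-tuple 'I_q; the sequence w below
   lists their letters as natural numbers. The letter written s_i with
   1 <= i <= n is [nth 0 w i.-1], so s_(k+2), ..., s_(n-1) is
   [drop k.+1 (take n.-1 w)]. [infix] is contiguous containment. *)
Definition crossbifix_free_set (k q n : nat) : {set n.-tuple 'I_q} :=
  [set s : n.-tuple 'I_q |
    let w := [seq val x | x <- s] in
    [&& take k w == nseq k 0,
        nth 0 w k != 0,
        nth 0 w n.-1 != 0
      & ~~ infix (nseq k 0) (drop k.+1 (take n.-1 w))]].

(* [wfib_values k q n] is F(n-1), ..., F(1), F(0), most recent value first;
   this makes the k-term recursion structural. The defining equations of F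
   are [wfib_init] and [wfib_rec]. *)
Fixpoint wfib_values (k q n : nat) : seq nat :=
  if n is m.+1 then
    let s := wfib_values k q m in
    (if m < k then q ^ m else (q - 1) * sumn (take k s)) :: s
  else [::].

Definition wfib (k q n : nat) : nat := head 0 (wfib_values k q n.+1).

Lemma size_wfib_values k q n : size (wfib_values k q n) = n.
Proof. by elim: n => //= n ->. Qed.

Lemma nth_wfib_values k q n l :
  l < n -> nth 0 (wfib_values k q n) l = wfib k q (n - l.+1).
Proof.
elim: n l => // n IHn [|l] lt_l_n; first by rewrite subSS subn0.
by rewrite subSS -IHn.
Qed.

Lemma wfib_init k q n : n < k -> wfib k q n = q ^ n.
Proof. by rewrite /wfib /= => ->. Qed.

Lemma wfib_rec k q n : k <= n ->
  wfib k q n = (q - 1) * \sum_(1 <= l < k.+1) wfib k q (n - l).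
Proof.
move=> le_k_n; rewrite {1}/wfib /= ltnNge le_k_n /=; congr (_ * _).
rewrite sumnE (big_nth 0) size_take size_wfib_values.
have -> : (if k < n then k else n) = k.
  by case: ltnP => // le_n_k; apply/eqP; rewrite eqn_leq le_n_k le_k_n.
rewrite big_add1 /=; apply: eq_big_nat => l /andP[_ lt_l_k].
by rewrite nth_take // nth_wfib_values // (leq_trans lt_l_k).
Qed.

(* Main.v *)
Require Import Defs.
From mathcomp Require Import all_boot.

Set Implicit Arguments.
Unset Strict Implicit.
Unset Printing Implicit Defensive.

(** Let [A j m] be the number of words [u] of length [m] such that [0^j u] has no
    run of [k] zeros. For [j < k], reading the first letter of [u] gives
    [A j m.+1 = A j.+1 m + (q - 1) * A 0 m], because a nonzero letter makes the
    past irrelevant. As [A k m = 0], unrolling this [k] times from [j = 0] gives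
    the recursion of F; and [A 0 m = q ^ m] for [m < k]. A word of the set is
    [0^k x u y] with [x], [y] nonzero and [u] counted by [A 0 (n - k - 2)]. *)

Definition zero_run_free (k q j m : nat) : {set m.-tuple 'I_q} :=
  [set u : m.-tuple 'I_q |
    ~~ infix (nseq k 0) (nseq j 0 ++ [seq val x | x <- u])].

(** A run of [a] cannot cross [x], and the [j < k] copies in front of [x] are too few to hold one of
    length [k]. *)
Lemma infix_nseq_cat_neq (T : eqType) (a x : T) (k j : nat) (u : seq T) :
  j < k -> x != a ->
  infix (nseq k a) (nseq j a ++ x :: u) = infix (nseq k a) u.
Proof.
move=> lt_jk neq_xa.
have not_prefix i : i < k -> prefix (nseq k a) (nseq i a ++ x :: u) = false.
  elim: i {lt_jk} k => [|i IHi] [|k'] //= lt_ik; last by rewrite eqxx IHi.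
  by rewrite eq_sym (negPf neq_xa).
elim: j lt_jk => [|j IHj] lt_jk.
  by rewrite [_ ++ _]/= infix_consl (not_prefix 0).
by rewrite [_ ++ _]/= infix_consl (not_prefix j.+1) // IHj // ltnW.
Qed.

(** Splits a count by the first letter. [P] lives on sequences so that one predicate serves both
    lengths. *)
Lemma card_set_tuple_cons (T : finType) (m : nat) (P : pred (seq T)) :
  #|[set t : m.+1.-tuple T | P t]|
    = \sum_(x : T) #|[set t : m.-tuple T | P (x :: t)]|.
Proof.
pose f (p : T * m.-tuple T) := cons_tuple p.1 p.2.
have f_bij : bijective f.
  exists (fun t => (thead t, [tuple of behead t])) => [[x u]|t].
    by congr pair; apply: val_inj.
  by apply: val_inj; case: t => -[].
rewrite -sum1dep_card big_mkcond /= (reindex f) /=; last exact: onW_bij.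
under [RHS]eq_bigr do rewrite -sum1dep_card big_mkcond /=.
by rewrite pair_big.
Qed.

Lemma card_zero_run_free_step (k q j m : nat) : 0 < q -> j < k ->
  #|zero_run_free k q j m.+1|
    = #|zero_run_free k q j.+1 m| + (q - 1) * #|zero_run_free k q 0 m|.
Proof.
case: q => // p _ lt_jk; rewrite subn1 /=.
rewrite (@card_set_tuple_cons _ m
  (fun s => ~~ infix (nseq k 0) (nseq j 0 ++ [seq val x | x <- s]))).
(* The letter [0] lengthens the zero run to [j.+1]; each of the other [p] letters erases it. *)
rewrite big_ord_recl; congr (_ + _).
  by apply: eq_card => u; rewrite !inE /= -cat1s catA -(nseqD j 1) addn1.
rewrite (eq_bigr (fun=> #|zero_run_free k p.+1 0 m|)).
  by rewrite sum_nat_const card_ord.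
by move=> x _; apply: eq_card => u; rewrite !inE /= infix_nseq_cat_neq.
Qed.

Lemma card_zero_run_free_full (k q m : nat) : #|zero_run_free k q k m| = 0.
Proof.
by apply: eq_card0 => u; rewrite !inE prefix_infix.
Qed.

Lemma card_zero_run_free_small (k q m : nat) :
  m < k -> #|zero_run_free k q 0 m| = q ^ m.
Proof.
move=> lt_mk; rewrite -[q in RHS]card_ord -card_tuple -cardsT.
apply: eq_card => u; rewrite !inE /=; apply/negP => /size_infix.
by rewrite size_nseq size_map size_tuple leqNgt lt_mk.
Qed.

(** The depth [d] is left free for induction; at [d = k] the first term vanishes. *)
Lemma card_zero_run_free_unroll (k q m d : nat) : 0 < q -> d <= k -> d <= m ->
  #|zero_run_free k q 0 m| = #|zero_run_free k q d (m - d)|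
    + (q - 1) * \sum_(1 <= l < d.+1) #|zero_run_free k q 0 (m - l)|.
Proof.
move=> q_gt0; elim: d => [|d IHd] le_dk le_dm.
  by rewrite subn0 big_geq // muln0 addn0.
rewrite IHd ?(ltnW le_dk) ?(ltnW le_dm) // [in RHS]big_nat_recr //= mulnDr.
rewrite -(subnSK le_dm) card_zero_run_free_step //.
by rewrite -addnA [(q - 1) * _ + _]addnC.
Qed.

Lemma card_zero_run_free (k q m : nat) : 0 < q -> 0 < k ->
  #|zero_run_free k q 0 m| = wfib k q m.
Proof.
move=> q_gt0 k_gt0; elim/ltn_ind: m => m IHm.
have [lt_mk|le_km] := ltnP m k.
  by rewrite card_zero_run_free_small // wfib_init.
rewrite (card_zero_run_free_unroll q_gt0 (leqnn k)) // card_zero_run_free_full wfib_rec //.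
congr (_ * _); apply: eq_big_nat => l /andP[l_gt0 lt_lk]; apply: IHm.
by rewrite ltn_subrL l_gt0 (leq_trans k_gt0).
Qed.

(** The map [word] sends [(x, u, y)] to [0^k x u y] and is a bijection from [D] onto the set. The
    length is written [k + m.+2] to match the type of this concatenation. *)
Lemma card_crossbifix_free_set (k q m : nat) : 0 < q ->
  #|crossbifix_free_set k q (k + m.+2)|
    = (q - 1) ^ 2 * #|zero_run_free k q 0 m|.
Proof.
case: q => // p _; rewrite subn1 /=.
pose word (t : 'I_p.+1 * m.-tuple 'I_p.+1 * 'I_p.+1) :=
  [tuple of nseq_tuple k ord0 ++ t.1.1 :: rcons t.1.2 t.2].
have word_inj : injective word.
  move=> [[x u] y] [[x' u'] y'] /(congr1 val)/= /eqP.
  rewrite eqseq_cat ?eqxx //= eqseq_cons eqseq_rcons.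
  by case/and3P => /eqP-> /eqP/val_inj-> /eqP->.
pose D := setX (setX [set~ @ord0 p] (zero_run_free k p.+1 0 m)) [set~ @ord0 p].
have card_D : #|D| = p ^ 2 * #|zero_run_free k p.+1 0 m|.
  by rewrite !cardsX !cardsC1 card_ord /= mulnAC mulnn.
rewrite -card_D -(card_imset _ word_inj).
have mem_word t : (word t \in crossbifix_free_set k p.+1 (k + m.+2)) = (t \in D).
  case: t => [[x u] y]; rewrite !inE /= !map_cat map_nseq /= map_rcons.
  set w := map _ u; have size_w : size w = m by rewrite size_map size_tuple.
  rewrite take_size_cat ?size_nseq // eqxx /=.
  rewrite !nth_cat size_nseq ltnn subnn /= addnS /= ltnNge addnS leqW ?leq_addr //=.
  rewrite -addnS addKn /= nth_rcons size_w ltnn eqxx.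
  rewrite take_cat size_nseq ltnNge leq_addr /= addKn /=.
  (* Attaching [x] to the zero block gives a prefix of length [k.+1], so the tested window is
     exactly [u]. *)
  rewrite -cats1 take_size_cat // -cat_rcons drop_size_cat ?size_rcons ?size_nseq //.
  by rewrite -!(inj_eq val_inj) /= andbA andbAC.
apply: eq_card => s; apply/idP/imsetP => [s_in|[t t_in ->]]; last by rewrite mem_word.
(* Only the shape of [s] is left to find: [mem_word] then carries membership over to [t]. *)
suff [t def_s] : exists t, s = word t.
  by exists t => //; rewrite -mem_word -def_s.
have take_s : take k s = nseq k ord0.
  move: s_in; rewrite inE => /andP[/eqP + _]; rewrite -map_take.
  have -> : nseq k 0 = map val (nseq k (@ord0 p)) by rewrite map_nseq.
  by move/(inj_map val_inj).
have size_drop_s : size (drop k s) = m.+2 by rewrite size_drop size_tuple addKn.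
case def_d: (drop k s) size_drop_s => [|x v] //=.
case/lastP: v def_d => // u y def_d [].
rewrite size_rcons => -[/eqP size_u].
exists (x, Tuple size_u, y); apply: val_inj => /=.
by rewrite -(cat_take_drop k s) take_s def_d.
Qed.

Theorem mainTheorem8 (q n k : nat) (hq : 2 <= q) (hn : 3 <= n)
    (hk : 2 <= k) (hkn : k <= n - 2) :
  #|crossbifix_free_set k q n| = (q - 1) ^ 2 * wfib k q (n - k - 2).
Proof.
have q_gt0 : 0 < q by apply: ltnW.
(* As [3 <= n], the subtraction in [k <= n - 2] is not truncated. *)
have [m def_n] : exists m, n = k + m.+2.
  by exists (n - k - 2); rewrite -addn2 subnAC addnA subnKC // subnK // ltnW.
subst n; rewrite card_crossbifix_free_set // addKn subn2 card_zero_run_free //.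
exact: ltnW.
Qed.
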